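(* Let $K\ge 1$, let $A$ be a binary treatment, $M_1,\dots,M_K$ binary causally ordered mediators and $Y$ a real outcome, with potential outcomes satisfying the composition and monotonicity assumptions (given in the context). For $k=0,\dots,K$ let $$\tau_k=\mathbb{E}\big[Y(1,\overline{1}_k)-Y(1,\overline{1}_{k-1},0)\big],$$ where for $k=0$ this means $\tau_0=\mathbb{E}[Y(1)-Y(0)]$ (the average treatment effect of $A$ on $Y$). For $k=0,\dots,K-1$ let $$\Delta_k=\mathbb{E}\big[Y(1,\overline{1}_{k},0)-Y(1,\overline{1}_{k-1},0)\big],$$ where for $k=0$ this means $\Delta_0=\mathbb{E}[Y(1,0)-Y(0)]=\mathbb{E}[Y(1,0)-Y(0,0)]$, and let $\Delta_K=\tau_K$. For $k=1,\dots,K$ let $$\pi_k=\mathbb{E}\big[M_k(1,\overline{1}_{k-1})\big],\qquad \eta_k=\mathrm{cov}\big[M_k(1,\overline{1}_{k-1}),\;Y(1,\overline{1}_k)-Y(1,\overline{1}_{k-1},0)\big].$$ Then for every $k\in\{0,\dots,K-1\}$, $$\tau_k=\Delta_k+\pi_{k+1}\tau_{k+1}+\eta_{k+1},$$ and consequently $$\tau_0=\Delta_0+\sum_{k=1}^{K}\Big[\Big(\prod_{j=1}^{k}\pi_j\Big)\Delta_k+\Big(\prod_{j=1}^{k-1}\pi_j\Big)\eta_k\Big],$$ where an empty product equals $1$.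
   Context: Notation. $\overline{1}_k$ denotes the vector $(M_1=1,\dots,M_k=1)$, which is empty for $k=0$, so $Y(1,\overline{1}_0)=Y(1)$. For $k\ge 1$, $Y(1,\overline{1}_{k-1},m_k)$ is the potential outcome when $A$ and $M_1,\dots,M_{k-1}$ are set to $1$ and $M_k$ is set to $m_k\in\{0,1\}$, all later mediators being left at the values they would naturally take. $Y(a)$ is the potential outcome when $A$ is set to $a$. $M_{k+1}(1,\overline{1}_{k-1},m_k)$ is the $\{0,1\}$-valued potential value of $M_{k+1}$ when $A,M_1,\dots,M_{k-1}$ are set to $1$ and $M_k$ to $m_k$; for $k=0$ it is $M_1(a)$. One writes $M_0\equiv A$, so that for $k=0$ the argument list $(1,\overline{1}_{k-1},m_k)$ is read as $(a)$ with $a=m_0$. All potential outcomes are random variables on one probability space, and $Y$-type potential outcomes are integrable. Composition assumption: for all $k\in\{0,\dots,K-1\}$ and $m_k\in\{0,1\}$, $$Y(1,\overline{1}_{k-1},m_k)=Y\big(1,\overline{1}_{k-1},m_k,M_{k+1}(1,\overline{1}_{k-1},m_k)\big);$$ for $k=0$ this reads $Y(a)=Y(a,M_1(a))$. Monotonicity assumption: for all $k\in\{0,\dots,K-1\}$, the potential value of $M_{k+1}$ is $0$ whenever $M_k$ is set to $0$, i.e. $M_{k+1}(1,\overline{1}_{k-1},0)=0$ (and $M_1(0)=0$ for $k=0$). *)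

(* Defs.v *)
From HB Require Import structures.
From mathcomp Require Import all_boot all_order all_algebra.
From mathcomp Require Import all_classical all_reals all_analysis.

Set Implicit Arguments.
Unset Strict Implicit.
Unset Printing Implicit Defensive.

Import Order.TTheory GRing.Theory Num.Theory.
Import numFieldNormedType.Exports.

Local Open Scope classical_set_scope.
Local Open Scope ring_scope.
Local Open Scope ereal_scope.

(* A joint intervention is a nonempty sequence s = [:: a; m_1; ...; m_i] that
   sets M_0 = A to a, M_1 to m_1, ..., M_i to m_i.  Potential outcomes are
   indexed by interventions: Y s is Y(a, m_1, ..., m_i), and M s is the
   potential value of the first mediator that s leaves free, that is
   M_{i+1}(a, m_1, ..., m_i), whose index is size s.  Values of Y and M at
   other sequences are irrelevant. *)

(* The argument list (1, \overline{1}_{k-1}, m): M_0, ..., M_{k-1} are set to 1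
   and M_k to m; it is (m) when k = 0. *)
Definition ones_then (k : nat) (m : bool) : seq bool := rcons (nseq k true) m.

Section MultipleMediators.
Context {d : measure_display} {T : measurableType d} {R : realType}.
Variable P : probability T R.
Variable Y : seq bool -> {RV P >-> R}.
Variable M : seq bool -> {RV P >-> bool}.

Definition outcomes_integrable (K : nat) : Prop :=
  forall (k : nat) (m : bool), (k <= K)%N ->
    P.-integrable setT (EFin \o Y (ones_then k m)).

Definition composition (K : nat) : Prop :=
  forall (k : nat) (m : bool), (k < K)%N ->
    {ae P, forall w,
      Y (ones_then k m) w =
      Y (rcons (ones_then k m) (M (ones_then k m) w)) w}.

Definition monotonicity (K : nat) : Prop :=
  forall k : nat, (k < K)%N ->
    {ae P, forall w, M (ones_then k false) w = false}.

(* Y(1, \overline{1}_k) - Y(1, \overline{1}_{k-1}, 0) *)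
Definition contrast (k : nat) : T -> R :=
  fun w => (Y (ones_then k true) w - Y (ones_then k false) w)%R.

Definition tau_ (k : nat) : \bar R := 'E_P[contrast k].

Definition Delta_ (K k : nat) : \bar R :=
  if k == K then tau_ K
  else 'E_P[fun w => (Y (ones_then k.+1 false) w - Y (ones_then k false) w)%R].

(* M_k(1, \overline{1}_{k-1}) as a real random variable, for k >= 1: all of
   M_0, ..., M_{k-1} are set to 1. *)
Definition mediator (k : nat) : T -> R := fun w => ((M (nseq k true) w)%:R)%R.

Definition pi_ (k : nat) : \bar R := 'E_P[mediator k].

Definition eta_ (k : nat) : \bar R := covariance P (mediator k) (contrast k).

End MultipleMediators.

Arguments outcomes_integrable {d T R} P Y K.
Arguments composition {d T R} P Y M K.
Arguments monotonicity {d T R} P M K.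
Arguments tau_ {d T R} P Y k.
Arguments Delta_ {d T R} P Y K k.
Arguments pi_ {d T R} P M k.
Arguments eta_ {d T R} P Y M k.

(* Main.v *)
(* By composition, Y(1, 1_k) = Y(1, 1_k, M_{k+1}(1, 1_k)) almost surely; as
   M_{k+1} is binary this is Y(1, 1_k, 0) + M_{k+1} * (Y(1, 1_{k+1}) - Y(1, 1_k, 0)).
   Taking expectations and splitting the expected product into the product of
   the expectations plus a covariance gives the recursion for tau_k, which is
   then unrolled.  All the quantities are finite since the mediators are
   bounded and the outcomes integrable, so the unrolling takes place in R. *)
Require Import Defs.
From HB Require Import structures.
From mathcomp Require Import all_boot all_order all_algebra.
From mathcomp Require Import all_classical all_reals all_analysis.
From mathcomp Require Import measurable_realfun ring.

Set Implicit Arguments.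
Unset Strict Implicit.
Unset Printing Implicit Defensive.

Import Order.TTheory GRing.Theory Num.Theory.
Import numFieldNormedType.Exports.

Local Open Scope classical_set_scope.
Local Open Scope ring_scope.
Local Open Scope ereal_scope.

(** The unrolling is pure algebra in a commutative ring. The extended reals are not one, so it is
    applied to the finite parts of the quantities. *)
Lemma backward_recursion_sum (S : comPzRingType) (t D p e : nat -> S) (K : nat) :
  (forall k, (k < K)%N -> t k = D k + p k.+1 * t k.+1 + e k.+1)%R ->
  D K = t K ->
  (t 0%N = D 0%N + \sum_(1 <= k < K.+1)
     ((\prod_(1 <= j < k.+1) p j) * D k + (\prod_(1 <= j < k) p j) * e k))%R.
Proof.
move=> tE DK.
(* partial sums, corrected by a remainder that vanishes at [n = K] *)
suff main n : (n <= K)%N -> (t 0%N = D 0%N + \sum_(1 <= k < n.+1)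
    ((\prod_(1 <= j < k.+1) p j) * D k + (\prod_(1 <= j < k) p j) * e k) +
    (\prod_(1 <= j < n.+1) p j) * (t n - D n))%R.
  by rewrite {1}(main K)// DK subrr mulr0 addr0.
elim: n => [_|n IH nK].
  by rewrite !big_geq// mul1r addr0 addrC subrK.
(* By [tE], [t n - D n] is [p n.+1 * t n.+1 + e n.+1]. Splitting [t n.+1] as
   [D n.+1 + (t n.+1 - D n.+1)] yields the summand of index [n.+1] and the new remainder. *)
rewrite IH 1?ltnW// (tE n)// [in RHS]big_nat_recr//=.
by rewrite ![in RHS](@big_nat_recr _ _ _ n.+1)//=; ring.
Qed.

Lemma Lfun1_bounded_mul d (T : measurableType d) (R : realType)
    (P : probability T R) (h f : T -> R) :
  measurable_fun setT h -> [bounded h x | x in setT] ->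
  f \in Lfun P 1 -> (h \* f)%R \in Lfun P 1.
Proof.
move=> mh bh /Lfun1_integrable f1; apply/Lfun1_integrable.
by have := integrableMr measurableT mh bh f1.
Qed.

Lemma expectation_ae_eq d (T : measurableType d) (R : realType)
    (P : probability T R) (f g : T -> R) :
  f \in Lfun P 1 -> g \in Lfun P 1 ->
  {ae P, forall w, f w = g w} -> 'E_P[f] = 'E_P[g].
Proof.
move=> /Lfun1_integrable f1 /Lfun1_integrable g1 fg; rewrite unlock.
apply: ae_eq_integral => //; [exact: measurable_int f1|exact: measurable_int g1|].
by apply: filterS fg => w + _ => /= ->.
Qed.

Section decomposition.
Context d (T : measurableType d) (R : realType) (P : probability T R).
Variables (Y : seq bool -> {RV P >-> R}) (M : seq bool -> {RV P >-> bool}).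
Variable K : nat.
Hypothesis hint : outcomes_integrable P Y K.
Hypothesis hcomp : composition P Y M K.

Lemma outcome_Lfun1 k m : (k <= K)%N ->
  (Y (ones_then k m) : T -> R) \in Lfun P 1.
Proof. by move=> kK; apply/Lfun1_integrable; exact: hint. Qed.

Lemma contrast_Lfun1 k : (k <= K)%N -> contrast Y k \in Lfun P 1.
Proof. by move=> kK; apply: rpredB; exact: outcome_Lfun1. Qed.

Lemma measurable_mediator k : measurable_fun setT (mediator (R := R) M k).
Proof.
by apply: (measurableT_comp (f := fun b : bool => b%:R%R : R)).
Qed.

Lemma bounded_mediator k : [bounded mediator (R := R) M k x | x in setT].
Proof.
exists 1%R; split => // x x1 w _ /=; apply: le_trans (ltW x1).
by rewrite /mediator; case: (M _ w); rewrite ?normr1 ?normr0.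
Qed.

Lemma mediator_Lfun1 k : mediator (R := R) M k \in Lfun P 1.
Proof.
rewrite -[mediator M k]mulr1; apply: Lfun1_bounded_mul.
- exact: measurable_mediator.
- exact: bounded_mediator.
- exact: Lfun_cst.
Qed.

(** A product of integrable functions need not be integrable; here boundedness of the mediator
    ensures it, so that the covariance is finite and can be expanded. *)
Lemma mediator_contrast_Lfun1 k : (k <= K)%N ->
  (mediator M k \* contrast Y k)%R \in Lfun P 1.
Proof.
move=> kK; apply: Lfun1_bounded_mul (contrast_Lfun1 kK).
- exact: measurable_mediator.
- exact: bounded_mediator.
Qed.

Lemma tau_fin_num k : (k <= K)%N -> tau_ P Y k \is a fin_num.
Proof. by move=> kK; rewrite expectation_fin_num// contrast_Lfun1. Qed.

Lemma pi_fin_num k : pi_ P M k \is a fin_num.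
Proof. by rewrite expectation_fin_num// mediator_Lfun1. Qed.

Lemma eta_fin_num k : (k <= K)%N -> eta_ P Y M k \is a fin_num.
Proof.
move=> kK; apply: covariance_fin_num.
- exact: mediator_Lfun1.
- exact: contrast_Lfun1.
- exact: mediator_contrast_Lfun1.
Qed.

Lemma Delta_fin_num k : (k <= K)%N -> Delta_ P Y K k \is a fin_num.
Proof.
move=> kK; rewrite /Delta_; case: eqP => [|/eqP kNK]; first by rewrite tau_fin_num.
by rewrite expectation_fin_num// rpredB// outcome_Lfun1// ltn_neqAle kNK.
Qed.

Lemma contrast_ae_decomposition k : (k < K)%N ->
  {ae P, forall w, contrast Y k w =
    (Y (ones_then k.+1 false) w - Y (ones_then k false) w +
     mediator M k.+1 w * contrast Y k.+1 w)%R}.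
Proof.
move=> kK; have := hcomp true kK; apply: filterS => w /=.
(* Composition indexes the mediator by [ones_then k true], [mediator k.+1] by [nseq k.+1 true]:
   these are the same list. *)
have nseqSr : ones_then k true = nseq k.+1 true.
  by rewrite /ones_then -cats1 -(nseqD k 1) addn1.
rewrite /contrast /mediator nseqSr => ->; rewrite -/(ones_then k.+1 _).
by case: (M _ w) => /=; ring.
Qed.

Lemma tau_recursion k : (k < K)%N ->
  tau_ P Y k = Delta_ P Y K k + pi_ P M k.+1 * tau_ P Y k.+1 + eta_ P Y M k.+1.
Proof.
move=> kK; have XC := mediator_contrast_Lfun1 kK.
have DE : (fun w => Y (ones_then k.+1 false) w - Y (ones_then k false) w)%R
    \in Lfun P 1 by apply: rpredB; apply: outcome_Lfun1 => //; exact: ltnW.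
(* The covariance is the expected product minus [pi_ * tau_]. That product is finite, so it cancels,
   and the two remaining expectations merge by linearity. *)
rewrite /eta_ covarianceE ?mediator_Lfun1 ?contrast_Lfun1//.
rewrite /Delta_ ltn_eqF// -addeA [pi_ _ _ _ * _ + _]addeC subeK; last first.
  by rewrite fin_numM ?pi_fin_num ?tau_fin_num.
rewrite -expectationD//; apply: expectation_ae_eq.
- by rewrite contrast_Lfun1// ltnW.
- exact: rpredD.
- exact: contrast_ae_decomposition.
Qed.

End decomposition.

Theorem mainTheorem1 (d : measure_display) (T : measurableType d)
  (R : realType) (P : probability T R) (K : nat)
  (Y : seq bool -> {RV P >-> R}) (M : seq bool -> {RV P >-> bool})
  (hK : (1 <= K)%N)
  (hint : outcomes_integrable P Y K)
  (hcomp : composition P Y M K)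
  (hmono : monotonicity P M K) :
  [/\ Delta_ P Y K 0 =
        'E_P[fun w => (Y [:: true; false] w - Y [:: false; false] w)%R],
      forall k : nat, (k < K)%N ->
        tau_ P Y k =
          Delta_ P Y K k + pi_ P M k.+1 * tau_ P Y k.+1 + eta_ P Y M k.+1
    & tau_ P Y 0 = Delta_ P Y K 0 +
        \sum_(1 <= k < K.+1)
          ((\prod_(1 <= j < k.+1) pi_ P M j) * Delta_ P Y K k +
           (\prod_(1 <= j < k) pi_ P M j) * eta_ P Y M k)].
Proof.
split.
(* Almost surely Y(0) = Y(0, M_1(0)) by composition, and this is Y(0, 0) by monotonicity. *)
- rewrite /Delta_ ltn_eqF// unlock; apply: ae_eq_integral => //.
  + by apply/measurable_EFinP/measurable_funB.
  + by apply/measurable_EFinP/measurable_funB.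
  + have := hcomp 0%N false hK; have := hmono 0%N hK.
    by apply: filterS2 => w M0 Y0 _; rewrite Y0 M0.
- by move=> k kK; exact: tau_recursion.
(* Finiteness of every term moves the recursion to the reals. *)
- have tE k : (k < K)%N -> (fine (tau_ P Y k) = fine (Delta_ P Y K k) +
      fine (pi_ P M k.+1) * fine (tau_ P Y k.+1) + fine (eta_ P Y M k.+1))%R.
    move=> kK; apply: EFin_inj; rewrite !EFinD EFinM !fineK.
    + exact: tau_recursion.
    + exact: eta_fin_num hint _ _.
    + exact: tau_fin_num hint _ _.
    + exact: pi_fin_num.
    + by apply: Delta_fin_num hint _ _; exact: ltnW.
    + by apply: tau_fin_num hint _ _; exact: ltnW.
  have DK : fine (Delta_ P Y K K) = fine (tau_ P Y K) by rewrite /Delta_ eqxx.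
  have := congr1 EFin (backward_recursion_sum
    (p := fun k => fine (pi_ P M k)) (e := fun k => fine (eta_ P Y M k)) tE DK).
  rewrite EFinD !fineK ?(tau_fin_num hint) ?(Delta_fin_num hint)// => ->.
  (* The real identity is carried back summand by summand; [kK] bounds the index by [K], where
     finiteness is known. *)
  congr (_ + _); rewrite -sumEFin; apply: eq_big_nat => k /andP[_ kK].
  rewrite EFinD !EFinM !fineK ?(eta_fin_num _ hint) ?(Delta_fin_num hint)//.
  by congr (_ * _ + _ * _); rewrite -prodEFin; apply: eq_bigr => j _;
    rewrite fineK// pi_fin_num.
Qed.
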